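(* Let $p>2$ be a prime, let $m,n,r>0$ be natural numbers, let $s>1$ be an integer, and let $\mathcal K$ be the (nonempty) key set. The set $\{T_s[k] : k\in\mathcal K\}$ of $s$-round generalized Rijndael-like functions on $M_{m,n}(\mathrm{GF}(p^r))$ does not form a group under functional composition if (i) $s$ is even and $\rho$ is an odd permutation, or else (ii) $s$ is odd and either $\pi$ or $\lambda$ is an odd permutation.
   Context: $M_{m,n}(\mathrm{GF}(p^r))$ is the set of $m\times n$ matrices over $\mathrm{GF}(p^r)$, with rows indexed by $0\le i<m$ and columns by $0\le j<n$. All maps below are permutations of the finite set $M_{m,n}(\mathrm{GF}(p^r))$, and ''odd''/''even'' refers to their parity as such. Component functions: - For $\kappa\in M_{m,n}(\mathrm{GF}(p^r))$, $\sigma[\kappa](a)=a+\kappa$ (entrywise addition). - $\lambda$ applies to every entry the same S-box: $\lambda(a)_{ij}=A\,a_{ij}^{-1}+B$ if $a_{ij}\ne 0$ and $\lambda(a)_{ij}=B$ if $a_{ij}=0$, where $A,B\in\mathrm{GF}(p^r)$ are fixed and $A\neq 0$ (so that the S-box is bijective). - $\pi$ is given by $\pi(a)_{ij}=a_{i,(j-c(i)) \bmod n}$, where $c:\{0,\dots,m-1\}\to\{0,\dots,n-1\}$ is a fixed map. - $\rho$ multiplies each column by a fixed invertible matrix $C\in M_{m,m}(\mathrm{GF}(p^r))$ (the ''diffusion matrix''), i.e. $\rho(a)=C a$. Each key $k\in\mathcal K$ produces, via a fixed key schedule, subkeys $k_1,\dots,k_{s+1}\in M_{m,n}(\mathrm{GF}(p^r))$.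 The $s$-round generalized Rijndael-like function is $$T_s[k]=\sigma[k_{s+1}]\circ\pi\circ\lambda\circ(\sigma[k_s]\circ\rho\circ\pi\circ\lambda)\circ\cdots\circ(\sigma[k_2]\circ\rho\circ\pi\circ\lambda)\circ\sigma[k_1],$$ with one bracketed factor for each $i=2,\dots,s$. *)

(* Defs.v *)
From HB Require Import structures.
From mathcomp Require Import all_boot all_order all_algebra all_fingroup.
Set Implicit Arguments.
Unset Strict Implicit.
Unset Printing Implicit Defensive.
Import GRing.Theory.
Local Open Scope ring_scope.

Section RijndaelLike.

Variables (F : finFieldType) (m n : nat).
Implicit Types (a kappa : 'M[F]_(m, n)) (A B x : F).

Definition sigma_perm kappa : {perm 'M[F]_(m, n)} := perm (@addIr _ kappa).

Definition sbox A B x : F := if x == 0 then B else A * x^-1 + B.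

Definition lambda_fun A B a : 'M[F]_(m, n) := \matrix_(i, j) sbox A B (a i j).

Lemma sbox_inj A B : A != 0 -> injective (sbox A B).
Proof.
move=> A0; have E x : sbox A B x = A * x^-1 + B.
  by rewrite /sbox; case: eqP => // ->; rewrite invr0 mulr0 add0r.
by move=> x y; rewrite !E => /addIr/(mulfI A0)/invr_inj.
Qed.

Lemma lambda_fun_inj A B : A != 0 -> injective (lambda_fun A B).
Proof.
move=> A0 a b /matrixP ab; apply/matrixP => i j.
by apply: (sbox_inj (B := B) A0); have := ab i j; rewrite !mxE.
Qed.

Definition lambda_perm A B (A_neq0 : A != 0) : {perm 'M[F]_(m, n)} :=
  perm (lambda_fun_inj (B := B) A_neq0).

Lemma shift_subproof (j d : 'I_n) : ((j + (n - d)) %% n < n)%N.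
Proof. by rewrite ltn_pmod // (leq_ltn_trans _ (ltn_ord j)). Qed.

(* (j - d) mod n; the representative n - d of - d avoids the truncated
   subtraction of nat. *)
Definition shift (j d : 'I_n) : 'I_n := Ordinal (shift_subproof j d).

Definition pi_fun (c : 'I_m -> 'I_n) a : 'M[F]_(m, n) :=
  \matrix_(i, j) a i (shift j (c i)).

Lemma shift_surj (d j : 'I_n) : exists j', shift j' d = j.
Proof.
have n0 : (0 < n)%N by exact: leq_ltn_trans (ltn_ord j).
exists (Ordinal (ltn_pmod (j + d) n0)); apply: val_inj => /=.
by rewrite modnDml -addnA subnKC ?(ltnW (ltn_ord d)) // modnDr modn_small.
Qed.

Lemma pi_fun_inj (c : 'I_m -> 'I_n) : injective (pi_fun c).
Proof.
move=> a b /matrixP ab; apply/matrixP => i j.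
by have [j' <-] := shift_surj (c i) j; have := ab i j'; rewrite !mxE.
Qed.

Definition pi_perm (c : 'I_m -> 'I_n) : {perm 'M[F]_(m, n)} :=
  perm (@pi_fun_inj c).

Lemma rho_inj (C : 'M[F]_m) :
  C \in unitmx -> injective (fun a : 'M[F]_(m, n) => C *m a).
Proof. by move=> CU; exact: can_inj (mulKmx CU). Qed.

Definition rho_perm (C : 'M[F]_m) (C_unit : C \in unitmx) :
    {perm 'M[F]_(m, n)} :=
  perm (rho_inj C_unit).

(* The product of {perm T} is diagrammatic, (f * g) x = g (f x), so every
   composition is written with the map applied first on the left; the factor
   of the big product with index i = 2 is applied first.  The subkeys are
   numbered from 1, and only k 1, ..., k s.+1 are used. *)
Definition rijndael_like (A B : F) (A_neq0 : A != 0) (c : 'I_m -> 'I_n)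
    (C : 'M[F]_m) (C_unit : C \in unitmx) (s : nat)
    (k : nat -> 'M[F]_(m, n)) : {perm 'M[F]_(m, n)} :=
  (sigma_perm (k 1%N)
   * (\prod_(2 <= i < s.+1)
       (lambda_perm B A_neq0 * pi_perm c * rho_perm C_unit * sigma_perm (k i)))
   * lambda_perm B A_neq0 * pi_perm c * sigma_perm (k s.+1))%g.

End RijndaelLike.

Arguments lambda_perm {F} m n {A} B A_neq0.
Arguments pi_perm F {m n} c.
Arguments rho_perm {F m} n {C} C_unit.

(* The elements satisfying P form a group for the product of gT.  On {perm T}
   that product is functional composition with its arguments swapped, which
   yields the same groups. *)
Definition forms_group (gT : finGroupType) (P : gT -> Prop) : Prop :=
  exists G : {group gT}, forall x, x \in G <-> P x.

(* Main.v *)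
Require Import Defs.
From HB Require Import structures.
From mathcomp Require Import all_boot all_order all_algebra all_fingroup finfield zify.
Set Implicit Arguments.
Unset Strict Implicit.
Unset Printing Implicit Defensive.
Import GRing.Theory.
Local Open Scope ring_scope.

(** The identity is an even permutation, so it is enough that every [T_s[k]]
is odd.

Key additions have order dividing [p], which is odd, and are therefore even.
Since the parity of a product is the sum of the parities, [T_s[k]] has, for
every key, the parity of [s] copies of lambda, [s] copies of pi and [s - 1]
copies of rho.  For [s] even this is the parity of rho.  For [s] odd it is the
sum of the parities of pi and lambda, so what remains to be excluded is that
both of these are odd.

They cannot be, because of the parity of the number [n] of columns: pi to the
power [n] is the identity, hence pi is even when [n] is odd; and lambda is even
when [n] is even, since it is then the product of two conjugate permutations,
namely its actions on the left and on the right half of the columns. *)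

Lemma odd_permX (T : finType) (s : {perm T}) N :
  odd_perm (s ^+ N)%g = odd N && odd_perm s.
Proof.
elim: N => [|N IHN]; first by rewrite expg0 odd_perm1.
by rewrite expgS odd_permM IHN /=; case: (odd N); case: odd_perm.
Qed.

Lemma odd_perm_oddX1 (T : finType) (s : {perm T}) N :
  odd N -> (s ^+ N = 1)%g -> odd_perm s = false.
Proof. by move=> oddN sN1; have := odd_permX s N; rewrite sN1 odd_perm1 oddN. Qed.

(** The [s - 1] middle rounds contribute their common parity [s - 1] times. *)
Lemma odd_perm_prod_const (T : finType) (f : nat -> {perm T}) b s :
  (forall i, odd_perm (f i) = b) -> (0 < s)%N ->
  odd_perm (\prod_(2 <= i < s.+1) f i)%g = ~~ odd s && b.
Proof.
move=> fb; case: s => // s _; elim: s => [|s IHs].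
  by rewrite big_geq // odd_perm1.
by rewrite big_nat_recr //= odd_permM IHs fb /=; case: (odd s); case: b {fb IHs}.
Qed.

Section Parities.

Variables (F : finFieldType) (m n : nat).
Implicit Types (a kappa : 'M[F]_(m, n)).

Lemma sigma_permX kappa N : (sigma_perm kappa ^+ N)%g = sigma_perm (kappa *+ N).
Proof.
apply/permP => a; rewrite permX permE.
elim: N => [|N IHN]; first by rewrite mulr0n addr0.
by rewrite iterS IHN permE mulrSr addrA.
Qed.

Lemma odd_sigma_perm kappa p :
  p \in [pchar F] -> (2 < p)%N -> odd_perm (sigma_perm kappa) = false.
Proof.
move=> pF p_gt2; apply: (@odd_perm_oddX1 _ _ p).
  by case: (even_prime (pcharf_prime pF)) p_gt2 => // ->.
rewrite sigma_permX -scaler_nat (pcharf0 pF) scale0r.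
by apply/permP => a; rewrite permE perm1 addr0.
Qed.

(** Applying pi [n] times shifts row [i] by [n * c i], a multiple of the length
of the row. *)
Lemma pi_permX (c : 'I_m -> 'I_n) : (pi_perm F c ^+ n)%g = 1%g.
Proof.
apply/permP => a; rewrite permX perm1; apply/matrixP => i j.
(* The shift by [c i] to the right is encoded as one by [n - c i] to the left,
   so the offset after [N] steps is [N * (n - c i)]. *)
have iterE N (j' : 'I_n) : j' = ((j + N * (n - c i)) %% n)%N :> nat ->
    iter N (pi_perm F c) a i j = a i j'.
  elim: N j j' => [|N IHN] j1 j' /= j'E.
    by congr (a i _); apply: val_inj; rewrite /= j'E mul0n addn0 modn_small.
  rewrite permE mxE; apply: IHN.
  by rewrite j'E /= modnDml mulSn addnA.
by apply: iterE; rewrite mulnC addnC modnMDl modn_small.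
Qed.

Lemma odd_pi_perm (c : 'I_m -> 'I_n) :
  odd n -> odd_perm (pi_perm F c) = false.
Proof. by move=> n_odd; apply: odd_perm_oddX1 n_odd (pi_permX c). Qed.

Section HalfLambda.

Variables (A B : F) (A_neq0 : A != 0).

Definition lambda_left_fun a : 'M[F]_(m, n) :=
  \matrix_(i, j) if (j < n./2)%N then sbox A B (a i j) else a i j.

Lemma lambda_left_fun_inj : injective lambda_left_fun.
Proof.
move=> a b /matrixP ab; apply/matrixP => i j.
by have := ab i j; rewrite !mxE; case: ifP => // _ /(sbox_inj A_neq0).
Qed.

Definition lambda_left : {perm 'M[F]_(m, n)} := perm lambda_left_fun_inj.

Definition mirror_fun a : 'M[F]_(m, n) := \matrix_(i, j) a i (rev_ord j).

Lemma mirror_funK : involutive mirror_fun.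
Proof. by move=> a; apply/matrixP => i j; rewrite !mxE rev_ordK. Qed.

Definition mirror : {perm 'M[F]_(m, n)} := perm (inv_inj mirror_funK).

Lemma mirrorV : (mirror^-1 = mirror)%g.
Proof.
apply/permP => a; apply: (@perm_inj _ mirror).
by rewrite permKV !permE mirror_funK.
Qed.

(** Reversing the order of the columns exchanges the two halves, so the second
factor acts as the S-box on the right half. *)
Lemma lambda_perm_halves : ~~ odd n ->
  lambda_perm m n B A_neq0 = (lambda_left * lambda_left ^ mirror)%g.
Proof.
move=> n_even; apply/permP => a; rewrite conjgE mirrorV !permM !permE.
apply/matrixP => i j; rewrite !mxE rev_ordK /=.
have -> : (n - j.+1 < n./2)%N = ~~ (j < n./2)%N.
  by rewrite -leqNgt; move: (ltn_ord j) (even_halfK n_even); lia.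
by case: (j < n./2)%N.
Qed.

(** Conjugate permutations have the same parity, so the two halves cancel. *)
Lemma odd_lambda_perm :
  ~~ odd n -> odd_perm (lambda_perm m n B A_neq0) = false.
Proof.
by move=> n_even; rewrite lambda_perm_halves // odd_permM odd_permJ addbb.
Qed.

End HalfLambda.

Lemma odd_rijndael_like (A B : F) (A_neq0 : A != 0) (c : 'I_m -> 'I_n)
    (C : 'M[F]_m) (C_unit : C \in unitmx) p s (k : nat -> 'M[F]_(m, n)) :
    p \in [pchar F] -> (2 < p)%N -> (0 < s)%N ->
  odd_perm (rijndael_like B A_neq0 c C_unit s k) =
    if odd s then odd_perm (lambda_perm m n B A_neq0) (+) odd_perm (pi_perm F c)
    else odd_perm (rho_perm n C_unit).
Proof.
move=> pF p_gt2 s_gt0; have sig kappa := odd_sigma_perm kappa pF p_gt2.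
rewrite /rijndael_like !odd_permM !sig.
under eq_bigr => i _ do rewrite -!mulgA.
rewrite (odd_perm_prod_const (b := odd_perm (lambda_perm m n B A_neq0) (+)
  odd_perm (pi_perm F c) (+) odd_perm (rho_perm n C_unit))) //.
  by case: (odd s); do 3!case: odd_perm.
by move=> i; rewrite !odd_permM sig addbF addbA.
Qed.

End Parities.

Theorem corollary34 (p m n r s : nat) (p_prime : prime p) (p_gt2 : (2 < p)%N)
    (m_gt0 : (0 < m)%N) (n_gt0 : (0 < n)%N) (r_gt0 : (0 < r)%N)
    (s_gt1 : (1 < s)%N)
    (F : finFieldType) (cardF : #|F| = (p ^ r)%N)
    (A B : F) (A_neq0 : A != 0)
    (c : 'I_m -> 'I_n)
    (C : 'M[F]_m) (C_unit : C \in unitmx)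
    (K : Type) (K_inhabited : inhabited K)
    (subkey : K -> nat -> 'M[F]_(m, n)) :
  (~~ odd s /\ odd_perm (rho_perm n C_unit)) \/
  (odd s /\ (odd_perm (pi_perm F c) \/ odd_perm (lambda_perm m n B A_neq0))) ->
  ~ forms_group (fun f : {perm 'M[F]_(m, n)} =>
      exists k : K, f = rijndael_like B A_neq0 c C_unit s (subkey k)).
Proof.
move=> parity [G GP].
have pF : p \in [pchar F] by apply: card_finPcharP cardF p_prime.
have [k /(congr1 (@odd_perm _))] := (GP 1%g).1 (group1 G).
rewrite odd_perm1 (odd_rijndael_like _ _ _ _ _ pF) // ?(ltnW s_gt1) //.
case: parity => [[/negPf-> ->] // | [-> pi_or_lambda]].
have [n_odd | n_even] := boolP (odd n).
  by move: pi_or_lambda; rewrite odd_pi_perm // addbF => -[] // ->.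
by move: pi_or_lambda; rewrite odd_lambda_perm // addFb => -[] // ->.
Qed.
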